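(* For non-flat, complex, multiply-transitive $(2,3,5)$-distributions, i.e. for the algebraic models $\mathsf N.7_c$ ($c\in\mathbb C$), $\mathsf N.6$, $\mathsf D.6_a$ ($a\in\mathbb C$), the infinitesimal holonomy algebra $\mathfrak{hol}\subset\mathfrak g$ is: - $\mathsf N.7_c$: $\mathfrak{hol}=\langle f_{01},f_{11},f_{21},f_{31},f_{32}\rangle$, which is isomorphic to the 5-dimensional Heisenberg algebra; - $\mathsf N.6$: $\mathfrak{hol}=\mathfrak g$; - $\mathsf D.6_a$ with $a\ne0$: $\mathfrak{hol}=\mathfrak g$; - $\mathsf D.6_0$: $\mathfrak{hol}=\langle h_{01},e_{01},f_{01},f_{21}+e_{21},f_{10}+e_{32},f_{11}+e_{31},f_{31}+e_{11},f_{32}+e_{10}\rangle$, which is isomorphic to $\mathfrak{sl}(3,\mathbb C)$.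
   Context: **$G_2$ data.** $\mathfrak g$ is the complex simple Lie algebra of type $G_2$, realised (with commutator bracket $[\cdot,\cdot]$) as the set of matrices $$\begin{pmatrix} 2z_1+z_2&b_{10}&b_{11}&\sqrt2 b_{21}&b_{31}&b_{32}&0\\ a_{10}&z_1+z_2&b_{01}&\sqrt2 b_{11}&-b_{21}&0&-b_{32}\\ a_{11}&a_{01}&z_1&-\sqrt2 b_{10}&0&b_{21}&-b_{31}\\ \sqrt2a_{21}&\sqrt2a_{11}&-\sqrt2a_{10}&0&\sqrt2b_{10}&-\sqrt2b_{11}&-\sqrt2b_{21}\\ a_{31}&-a_{21}&0&\sqrt2a_{10}&-z_1&-b_{01}&-b_{11}\\ a_{32}&0&a_{21}&-\sqrt2a_{11}&-a_{01}&-z_1-z_2&-b_{10}\\ 0&-a_{32}&-a_{31}&-\sqrt2a_{21}&-a_{11}&-a_{10}&-2z_1-z_2\end{pmatrix}.$$ $\mathsf Z_i$, $f_{st}$, $e_{st}$ denote the matrices for which $z_i$, $a_{st}$, $b_{st}$ respectively equals $1$ and all other parameters vanish; $h_{01}=[e_{01},f_{01}]=-\mathsf Z_1+2\mathsf Z_2$. Let $\mathfrak p=\langle\mathsf Z_1,\mathsf Z_2,e_{01},f_{01},e_{10},e_{11},e_{21},e_{31},e_{32}\rangle$. The $f_{st}^*$ ($st=10,11,21,31,32$) denote the basis of $(\mathfrak g/\mathfrak p)^*$ dual to the classes of the $f_{st}$, with $(\alpha\wedge\beta)(x,y)=\alpha(x)\beta(y)-\alpha(y)\beta(x)$. **Models.**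 Each model below is a subspace $\mathfrak f\subset\mathfrak g$ with curvature $\kappa\in\bigwedge^2(\mathfrak g/\mathfrak p)^*\otimes\mathfrak g$, and is a Lie algebra for $[x,y]_{\mathfrak f}=[x,y]-\kappa(x,y)$; with $\mathfrak f^0=\mathfrak f\cap\mathfrak p$ one has $\mathfrak f/\mathfrak f^0\cong\mathfrak g/\mathfrak p$, and the model encodes the regular, normal Cartan geometry of type $(G_2,P_1)$ of a homogeneous $(2,3,5)$-distribution. $\mathsf N.7_c$: basis $\mathsf Z_2$, $f_{01}$, $f_{10}+ce_{10}$, $f_{11}$, $f_{21}$, $f_{31}$, $f_{32}$; $\kappa=f_{10}^*\wedge f_{31}^*\otimes f_{01}$. $\mathsf N.6$: basis $f_{01}$, $f_{10}+e_{01}+6e_{10}+2e_{32}$, $f_{11}+\mathsf Z_1-2\mathsf Z_2+2e_{31}$, $f_{21}+9e_{10}+2e_{21}$, $f_{31}-2\mathsf Z_1+\mathsf Z_2-e_{11}-4e_{31}$, $f_{32}-e_{10}$; $\kappa=42\kappa_4-30\kappa_5+20\kappa_6-4\kappa_7+6\kappa_8$, where $\kappa_4=f_{10}^*\wedge f_{31}^*\otimes f_{01}$, $\kappa_5=f_{10}^*\wedge f_{31}^*\otimes e_{10}-2f_{21}^*\wedge f_{31}^*\otimes f_{01}$, $\kappa_6=-f_{10}^*\wedge f_{31}^*\otimes e_{21}-2f_{21}^*\wedge f_{31}^*\otimes e_{10}+f_{31}^*\wedge f_{32}^*\otimes f_{01}$, $\kappa_7=(f_{10}^*\wedge f_{32}^*-f_{11}^*\wedge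 f_{31}^* )\otimes e_{31}-2f_{10}^*\wedge f_{31}^*\otimes e_{32}+6f_{21}^*\wedge f_{31}^*\otimes e_{21}+3f_{31}^*\wedge f_{32}^*\otimes e_{10}$, $\kappa_8=f_{21}^*\wedge f_{31}^*\otimes e_{32}-f_{21}^*\wedge f_{32}^*\otimes e_{31}-f_{31}^*\wedge f_{32}^*\otimes e_{21}$. $\mathsf D.6_a$: basis $h_{01}$, $f_{10}+ae_{11}+e_{32}$, $f_{11}+ae_{10}+e_{31}$, $f_{21}+(a^2+1)e_{21}$, $f_{31}+e_{11}+a(a^2+\tfrac13)e_{32}$, $f_{32}+e_{10}+a(a^2+\tfrac13)e_{31}$; $\kappa=-4\kappa_4+\tfrac{4a}{3}\kappa_6-2a^2\kappa_8$, where $\kappa_4=(f_{10}^*\wedge f_{32}^*-f_{11}^*\wedge f_{31}^* )\otimes h_{01}-f_{10}^*\wedge f_{31}^*\otimes e_{01}-f_{11}^*\wedge f_{32}^*\otimes f_{01}$, $\kappa_6=(f_{11}^*\wedge f_{31}^*-f_{10}^*\wedge f_{32}^* )\otimes e_{21}-2f_{21}^*\wedge f_{32}^*\otimes e_{10}+2f_{21}^*\wedge f_{31}^*\otimes e_{11}+f_{31}^*\wedge f_{32}^*\otimes h_{01}$, $\kappa_8=f_{21}^*\wedge f_{31}^*\otimes e_{32}-f_{21}^*\wedge f_{32}^*\otimes e_{31}-f_{31}^*\wedge f_{32}^*\otimes e_{21}$. **Holonomy.** $\mathfrak{hol}^0:=\langle\kappa(x,y):x,y\in\mathfrak f\rangle$,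 $\mathfrak{hol}^i:=\mathfrak{hol}^{i-1}+[\mathfrak f,\mathfrak{hol}^{i-1}]$ for $i\ge1$ (bracket of $\mathfrak g$); $\mathfrak{hol}$ is the stable value of this increasing sequence of subspaces. *)

(* Defs.v *)
From HB Require Import structures.
From mathcomp Require Import all_boot all_order all_algebra.
From mathcomp Require Import reals.
From mathcomp Require Export complex.
From mathcomp Require Import ring.

Set Implicit Arguments.
Unset Strict Implicit.
Unset Printing Implicit Defensive.

Import GRing.Theory Num.Theory.
Local Open Scope ring_scope.

(* The theory is set up over an arbitrary [numClosedFieldType]; the statement
   instantiates it at the complex numbers R[i]. *)

Definition lie (F : fieldType) (n : nat) (x y : 'M[F]_n) : 'M[F]_n :=
  x *m y - y *m x.

Definition lie_subalgebra (F : fieldType) (n : nat) (U : {vspace 'M[F]_n}) :=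
  {in U &, forall x y, lie x y \in U}.

(* Isomorphism of matrix Lie algebras.  Only the restriction of phi to U
   matters; a linear map on U always extends to the ambient matrix space. *)
Definition lie_isomorphic (F : fieldType) (m n : nat)
    (U : {vspace 'M[F]_m}) (V : {vspace 'M[F]_n}) : Prop :=
  [/\ lie_subalgebra U, lie_subalgebra V &
    exists phi : 'Hom('M[F]_m, 'M[F]_n),
      [/\ (phi @: U)%VS = V, (U :&: lker phi)%VS = 0%VS &
          {in U &, forall x y, phi (lie x y) = lie (phi x) (phi y)}]].

Definition sl (F : fieldType) (n : nat) : {vspace 'M[F]_n} :=
  lker (linfun (@mxtrace F n : 'M[F]_n -> F^o)).

Lemma memv_sl (F : fieldType) (n : nat) (x : 'M[F]_n) :
  (x \in sl F n) = (\tr x == 0).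
Proof. by rewrite memv_ker lfunE. Qed.

(* The Heisenberg algebra of dimension 2n+1, as the matrices of size n+2 that
   vanish off the first row and the last column and on the diagonal. *)
Definition heisenberg (F : fieldType) (n : nat) : {vspace 'M[F]_n.+2} :=
  <<[seq delta_mx ord0 (lift ord0 (widen_ord (leqnSn n) i)) | i : 'I_n]
    ++ [seq delta_mx (lift ord0 (widen_ord (leqnSn n) i)) ord_max | i : 'I_n]
    ++ [:: delta_mx ord0 ord_max]>>%VS.

(* The subspace spanned by all B x y with x in U and y in V, for bilinear B
   (see [bispan_subP]); compare [prodv]. *)
Definition bispan (F : fieldType) (vT : vectType F)
    (B : vT -> vT -> vT) (U V : {vspace vT}) : {vspace vT} :=
  <<[seq B x y | x <- vbasis U, y <- vbasis V]>>%VS.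

Definition bilin (F : fieldType) (vT : vectType F) (B : vT -> vT -> vT) :=
  (forall y, linear (B^~ y)) /\ (forall x, linear (B x)).

Lemma bispan_subP (F : fieldType) (vT : vectType F) (B : vT -> vT -> vT)
    (U V W : {vspace vT}) : bilin B ->
  (bispan B U V <= W)%VS <-> (forall x y, x \in U -> y \in V -> B x y \in W).
Proof.
move=> [Bl Br]; split=> [/span_subvP sBW x y Ux Vy|BW].
  rewrite (coord_vbasis Ux) (coord_vbasis Vy).
  have B0l z : B 0 z = 0.
    by have := Bl z (-1) 0 0; rewrite scaler0 addr0 scaleN1r addNr.
  have B0r z : B z 0 = 0.
    by have := Br z (-1) 0 0; rewrite scaler0 addr0 scaleN1r addNr.
  elim/big_rec: _ => [|i u _ IHu]; first by rewrite B0l mem0v.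
  rewrite Bl memvD// memvZ//.
  elim/big_rec: _ {IHu} => [|j v _ IHv]; first by rewrite B0r mem0v.
  rewrite Br memvD// memvZ// sBW//.
  by apply/allpairsP; exists ((vbasis U)`_i, (vbasis V)`_j);
     rewrite /= !mem_nth ?size_tuple.
apply/span_subvP => _ /allpairsP[[x y] /= [Ux Vy ->]].
by apply: BW; apply: vbasis_mem.
Qed.

Lemma lie_bilin (F : fieldType) (n : nat) : bilin (@lie F n).
Proof.
split=> [y|x] a u v; rewrite /lie.
  by rewrite mulmxDl mulmxDr -scalemxAl -scalemxAr scalerBr opprD addrACA.
by rewrite mulmxDl mulmxDr -scalemxAl -scalemxAr scalerBr opprD addrACA.
Qed.

Section G2.
Context {C : numClosedFieldType}.
Implicit Types x y : 'M[C]_7.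

Definition g2mx (z1 z2 a10 a01 a11 a21 a31 a32 b10 b01 b11 b21 b31 b32 : C)
    : 'M[C]_7 :=
  let s := sqrtC 2 in
  \matrix_(i < 7, j < 7) nth 0 (nth [::] [::
    [:: 2 * z1 + z2; b10; b11; s * b21; b31; b32; 0];
    [:: a10; z1 + z2; b01; s * b11; - b21; 0; - b32];
    [:: a11; a01; z1; - (s * b10); 0; b21; - b31];
    [:: s * a21; s * a11; - (s * a10); 0; s * b10; - (s * b11); - (s * b21)];
    [:: a31; - a21; 0; s * a10; - z1; - b01; - b11];
    [:: a32; 0; a21; - (s * a11); - a01; - z1 - z2; - b10];
    [:: 0; - a32; - a31; - (s * a21); - a11; - a10; - (2 * z1) - z2]
  ] i) j.

Definition Z1  := g2mx 1 0 0 0 0 0 0 0 0 0 0 0 0 0.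
Definition Z2  := g2mx 0 1 0 0 0 0 0 0 0 0 0 0 0 0.
Definition f10 := g2mx 0 0 1 0 0 0 0 0 0 0 0 0 0 0.
Definition f01 := g2mx 0 0 0 1 0 0 0 0 0 0 0 0 0 0.
Definition f11 := g2mx 0 0 0 0 1 0 0 0 0 0 0 0 0 0.
Definition f21 := g2mx 0 0 0 0 0 1 0 0 0 0 0 0 0 0.
Definition f31 := g2mx 0 0 0 0 0 0 1 0 0 0 0 0 0 0.
Definition f32 := g2mx 0 0 0 0 0 0 0 1 0 0 0 0 0 0.
Definition e10 := g2mx 0 0 0 0 0 0 0 0 1 0 0 0 0 0.
Definition e01 := g2mx 0 0 0 0 0 0 0 0 0 1 0 0 0 0.
Definition e11 := g2mx 0 0 0 0 0 0 0 0 0 0 1 0 0 0.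
Definition e21 := g2mx 0 0 0 0 0 0 0 0 0 0 0 1 0 0.
Definition e31 := g2mx 0 0 0 0 0 0 0 0 0 0 0 0 1 0.
Definition e32 := g2mx 0 0 0 0 0 0 0 0 0 0 0 0 0 1.

Definition h01 := lie e01 f01.

Definition g2 : {vspace 'M[C]_7} :=
  <<[:: Z1; Z2; f10; f01; f11; f21; f31; f32;
        e10; e01; e11; e21; e31; e32]>>%VS.

Definition p1 : {vspace 'M[C]_7} :=
  <<[:: Z1; Z2; e01; f01; e10; e11; e21; e31; e32]>>%VS.

Lemma g2mxE z1 z2 a10 a01 a11 a21 a31 a32 b10 b01 b11 b21 b31 b32 :
  g2mx z1 z2 a10 a01 a11 a21 a31 a32 b10 b01 b11 b21 b31 b32 =
  z1 *: Z1 + (z2 *: Z2 + (a10 *: f10 + (a01 *: f01 + (a11 *: f11 +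
  (a21 *: f21 + (a31 *: f31 + (a32 *: f32 + (b10 *: e10 + (b01 *: e01 +
  (b11 *: e11 + (b21 *: e21 + (b31 *: e31 + b32 *: e32)))))))))))).
Proof.
apply/matrixP => i j; rewrite !mxE.
case: i => [[|[|[|[|[|[|[|//]]]]]]] ?]; case: j => [[|[|[|[|[|[|[|//]]]]]]] ?] /=; ring.
Qed.

Lemma g2P x : reflect
  (exists z1 z2 a10 a01 a11 a21 a31 a32 b10 b01 b11 b21 b31 b32,
     x = g2mx z1 z2 a10 a01 a11 a21 a31 a32 b10 b01 b11 b21 b31 b32)
  (x \in g2).
Proof.
apply: (iffP idP) => [|[z1[z2[a10[a01[a11[a21[a31[a32[b10[b01[b11[b21[b31[b32]]]]]]]]]]]]]]].
  rewrite /g2; do 13 rewrite span_cons => /memv_addP[_ /vlineP[? ->] [? + ->]].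
  rewrite span_seq1 => /vlineP[? ->].
  by do 14 eexists; rewrite g2mxE; reflexivity.
move->; rewrite g2mxE /g2.
by do !apply: memvD; apply/memvZ/memv_span; rewrite !inE eqxx ?orbT.
Qed.

Lemma h01E : h01 = - Z1 + 2 *: Z2.
Proof.
apply/matrixP => i j; rewrite !mxE !big_ord_recl !big_ord0 !mxE.
case: i => [[|[|[|[|[|[|[|//]]]]]]] ?]; case: j => [[|[|[|[|[|[|[|//]]]]]]] ?] /=; ring.
Qed.

(* The basis of (g/p)^* dual to the classes of the f_st, lifted to forms that
   vanish on p; the value on g2mx is the parameter a_st (see [fdual_g2mx],
   [fdual_p1]).  They are read off from the first column. *)
Definition f10' x : C := x (inord 1) ord0.
Definition f11' x : C := x (inord 2) ord0.
Definition f21' x : C := x (inord 3) ord0 / sqrtC 2.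
Definition f31' x : C := x (inord 4) ord0.
Definition f32' x : C := x (inord 5) ord0.

Lemma fdual_g2mx z1 z2 a10 a01 a11 a21 a31 a32 b10 b01 b11 b21 b31 b32 :
  let x := g2mx z1 z2 a10 a01 a11 a21 a31 a32 b10 b01 b11 b21 b31 b32 in
  [/\ f10' x = a10, f11' x = a11, f21' x = a21, f31' x = a31 & f32' x = a32].
Proof.
rewrite /f10' /f11' /f21' /f31' /f32' !mxE !inordK//=; split=> //.
by rewrite mulrAC mulfV ?mul1r// sqrtC_eq0 pnatr_eq0.
Qed.

Lemma fdual_linear :
  [/\ linear (f10' : _ -> C^o), linear (f11' : _ -> C^o),
      linear (f21' : _ -> C^o), linear (f31' : _ -> C^o) &
      linear (f32' : _ -> C^o)].
Proof.
by split=> a u v; rewrite /f10' /f11' /f21' /f31' /f32' !mxE// mulrDl -mulrA.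
Qed.

Lemma fdual_p1 x : x \in p1 ->
  [/\ f10' x = 0, f11' x = 0, f21' x = 0, f31' x = 0 & f32' x = 0].
Proof.
rewrite /p1.
rewrite span_cons => /memv_addP[_ /vlineP[z1 ->] [? + ->]].
rewrite span_cons => /memv_addP[_ /vlineP[z2 ->] [? + ->]].
rewrite span_cons => /memv_addP[_ /vlineP[b01 ->] [? + ->]].
rewrite span_cons => /memv_addP[_ /vlineP[a01 ->] [? + ->]].
rewrite span_cons => /memv_addP[_ /vlineP[b10 ->] [? + ->]].
rewrite span_cons => /memv_addP[_ /vlineP[b11 ->] [? + ->]].
rewrite span_cons => /memv_addP[_ /vlineP[b21 ->] [? + ->]].
rewrite span_cons => /memv_addP[_ /vlineP[b31 ->] [? + ->]].
rewrite span_seq1 => /vlineP[b32 ->].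
have := fdual_g2mx z1 z2 0 a01 0 0 0 0 b10 b01 b11 b21 b31 b32.
rewrite /= g2mxE !scale0r !add0r.
by rewrite [b10 *: e10 + _]addrCA [a01 *: f01 + _]addrCA.
Qed.

Definition wedge (al be : 'M[C]_7 -> C) x y : C :=
  al x * be y - al y * be x.
Local Notation "al ∧ be" := (wedge al be) (at level 39, no associativity).

(* [curv] is a section of /\^2 (g/p)^* (x) g, as an alternating bilinear map. *)
Record model := Model {
  carrier : {vspace 'M[C]_7};
  curv : 'M[C]_7 -> 'M[C]_7 -> 'M[C]_7 }.

Fixpoint holn (m : model) (i : nat) : {vspace 'M[C]_7} :=
  if i is j.+1 then (holn m j + bispan (@lie C 7) (carrier m) (holn m j))%VS
  else bispan (curv m) (carrier m) (carrier m).

(* hol, the stable value of the increasing sequence hol^i, is h. *)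
Definition is_hol (m : model) (h : {vspace 'M[C]_7}) : Prop :=
  exists N : nat, forall i : nat, (N <= i)%N -> holn m i = h.

Definition modelN7 (c : C) : model := {|
  carrier := <<[:: Z2; f01; f10 + c *: e10; f11; f21; f31; f32]%R>>%VS;
  curv := fun x y => (f10' ∧ f31') x y *: f01 |}.

Definition modelN6 : model := {|
  carrier := <<[::
    f01;
    f10 + e01 + 6 *: e10 + 2 *: e32;
    f11 + Z1 - 2 *: Z2 + 2 *: e31;
    f21 + 9 *: e10 + 2 *: e21;
    f31 - 2 *: Z1 + Z2 - e11 - 4 *: e31;
    f32 - e10]%R>>%VS;
  curv := fun x y =>
    let k4 := (f10' ∧ f31') x y *: f01 in
    let k5 := (f10' ∧ f31') x y *: e10 - 2 *: ((f21' ∧ f31') x y *: f01) in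
    let k6 := - ((f10' ∧ f31') x y *: e21)
              - 2 *: ((f21' ∧ f31') x y *: e10) + (f31' ∧ f32') x y *: f01 in
    let k7 := ((f10' ∧ f32') x y - (f11' ∧ f31') x y) *: e31
              - 2 *: ((f10' ∧ f31') x y *: e32)
              + 6 *: ((f21' ∧ f31') x y *: e21)
              + 3 *: ((f31' ∧ f32') x y *: e10) in
    let k8 := (f21' ∧ f31') x y *: e32 - (f21' ∧ f32') x y *: e31
              - (f31' ∧ f32') x y *: e21 in
    42 *: k4 - 30 *: k5 + 20 *: k6 - 4 *: k7 + 6 *: k8 |}.

Definition modelD6 (a : C) : model := {|
  carrier := <<[::
    h01;
    f10 + a *: e11 + e32;
    f11 + a *: e10 + e31;
    f21 + (a ^+ 2 + 1) *: e21;
    f31 + e11 + (a * (a ^+ 2 + 1 / 3)) *: e32;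
    f32 + e10 + (a * (a ^+ 2 + 1 / 3)) *: e31]%R>>%VS;
  curv := fun x y =>
    let k4 := ((f10' ∧ f32') x y - (f11' ∧ f31') x y) *: h01
              - (f10' ∧ f31') x y *: e01 - (f11' ∧ f32') x y *: f01 in
    let k6 := ((f11' ∧ f31') x y - (f10' ∧ f32') x y) *: e21
              - 2 *: ((f21' ∧ f32') x y *: e10)
              + 2 *: ((f21' ∧ f31') x y *: e11) + (f31' ∧ f32') x y *: h01 in
    let k8 := (f21' ∧ f31') x y *: e32 - (f21' ∧ f32') x y *: e31
              - (f31' ∧ f32') x y *: e21 in
    (- 4) *: k4 + (4 * a / 3) *: k6 - (2 * a ^+ 2) *: k8 |}.

Lemma wedge_bilin al be v :
  linear (al : _ -> C^o) -> linear (be : _ -> C^o) ->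
  bilin (fun x y => (al ∧ be) x y *: v).
Proof.
move=> la lb; split=> [y|x] a u w; rewrite /wedge la lb /= scalerA -scalerDl;
  by congr (_ *: _); rewrite /GRing.scale /=; ring.
Qed.

Lemma bilin_ext (B B' : 'M[C]_7 -> 'M[C]_7 -> 'M[C]_7) :
  (forall x y, B x y = B' x y) -> bilin B -> bilin B'.
Proof. by move=> E [Bl Br]; split=> [y|x] a u w; rewrite -!E ?Bl ?Br. Qed.

Lemma bilinD (B B' : 'M[C]_7 -> 'M[C]_7 -> 'M[C]_7) :
  bilin B -> bilin B' -> bilin (fun x y => B x y + B' x y).
Proof.
by move=> [Bl Br] [Bl' Br']; split=> [y|x] a u w;
  rewrite ?Bl ?Bl' ?Br ?Br' scalerDr addrACA.
Qed.

Lemma bilinZ k (B : 'M[C]_7 -> 'M[C]_7 -> 'M[C]_7) :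
  bilin B -> bilin (fun x y => k *: B x y).
Proof.
by move=> [Bl Br]; split=> [y|x] a u w;
  rewrite ?Bl ?Br scalerDr !scalerA mulrC.
Qed.

Lemma bilinN (B : 'M[C]_7 -> 'M[C]_7 -> 'M[C]_7) :
  bilin B -> bilin (fun x y => - B x y).
Proof.
by move=> [Bl Br]; split=> [y|x] a u w; rewrite ?Bl ?Br opprD scalerN.
Qed.

Lemma wedgeB_bilin al be al' be' v :
  linear (al : _ -> C^o) -> linear (be : _ -> C^o) ->
  linear (al' : _ -> C^o) -> linear (be' : _ -> C^o) ->
  bilin (fun x y => ((al ∧ be) x y - (al' ∧ be') x y) *: v).
Proof.
move=> la lb la' lb'.
have := bilinD (wedge_bilin v la lb) (bilinN (wedge_bilin v la' lb')).
by apply: bilin_ext => x y; rewrite [RHS]scalerBl.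
Qed.

Lemma curv_bilin :
  [/\ forall c, bilin (curv (modelN7 c)), bilin (curv modelN6) &
      forall a, bilin (curv (modelD6 a))].
Proof.
have [l1 l2 l3 l4 l5] := fdual_linear.
by split=> [c||a] /=;
  do ![apply: bilinD | apply: bilinN | apply: wedgeB_bilin
      | apply: wedge_bilin | apply: bilinZ].
Qed.

End G2.

(* Main.v *)
Require Import Defs.
From HB Require Import structures.
From mathcomp Require Import all_boot all_order all_algebra.
From mathcomp Require Import reals ring.

Import GRing.Theory Num.Theory.
Local Open Scope ring_scope.

(** The holonomy algebra is the least subspace of the matrix space that
contains the values of the curvature on the carrier f and is stable under
bracketing with f ([is_hol_least]): the increasing sequence hol^i has to become
stationary for dimension reasons, and it stays inside every such subspace.
Identifying hol with a given h thus splits into two finite computations: h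
itself has the two closure properties, and every subspace W with them contains
a basis of h.  Both are carried out in the 14 coordinates of g, by means of the
bracket formula [lie_g2mx].

The first computation is direct: g is a Lie algebra containing f and the values
of the curvature; for N.7_c the candidate contains f_01 and is preserved by the
generators of f; for D.6_0 it is a subalgebra that contains f.  The second one
is a chase.  For N.6, the curvature takes the value 4 e_31 at the generators
that lift f_11 and f_31, and repeated brackets with f lead from the root vector
e_31 to all of g.  For D.6_a with a nonzero, two values of the curvature lie in
the plane spanned by h_01 and e_21, with determinant a nonzero multiple of a^2,
so that e_21 belongs to hol; bracketing e_21 with f again produces all of g.
When a = 0 one of these two values vanishes, the curvature only yields the
semisimple Levi part <h_01, e_01, f_01>, and its brackets with f close up on an
8-dimensional algebra.

The isomorphism with the Heisenberg algebra puts a Lagrangian splitting of the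
symplectic form of the nilpotent algebra <f_01, f_11, f_21, f_31, f_32> into
the first row and the last column of a matrix ([heis_g2_iso]).  The isomorphism
with sl_3 reflects that the restriction to SL_3 of the 7-dimensional
representation of G_2 splits as a 3-dimensional representation, its dual and a
line: the algebra preserves a 3-dimensional space, the span of the columns of
[triplet], and restricting to that space is the required isomorphism
([sl3_g2_iso]). *)

(** * Coordinates in the 7-dimensional representation *)

Section Coordinates.
Context {C : numClosedFieldType}.

Lemma sqrtC2_sqr : sqrtC 2 * sqrtC 2 = 2 :> C.
Proof. by rewrite -expr2 sqrtCK. Qed.

Lemma g2mxD z1 z2 a10 a01 a11 a21 a31 a32 b10 b01 b11 b21 b31 b32
    z1' z2' a10' a01' a11' a21' a31' a32' b10' b01' b11' b21' b31' b32' :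
  @g2mx C z1 z2 a10 a01 a11 a21 a31 a32 b10 b01 b11 b21 b31 b32 +
  g2mx z1' z2' a10' a01' a11' a21' a31' a32' b10' b01' b11' b21' b31' b32' =
  g2mx (z1 + z1') (z2 + z2') (a10 + a10') (a01 + a01') (a11 + a11')
    (a21 + a21') (a31 + a31') (a32 + a32') (b10 + b10') (b01 + b01')
    (b11 + b11') (b21 + b21') (b31 + b31') (b32 + b32').
Proof.
apply/matrixP => i j; rewrite !mxE.
by case: i => [[|[|[|[|[|[|[|//]]]]]]] ?];
   case: j => [[|[|[|[|[|[|[|//]]]]]]] ?] /=; ring.
Qed.

Lemma g2mxZ k z1 z2 a10 a01 a11 a21 a31 a32 b10 b01 b11 b21 b31 b32 :
  k *: @g2mx C z1 z2 a10 a01 a11 a21 a31 a32 b10 b01 b11 b21 b31 b32 =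
  g2mx (k * z1) (k * z2) (k * a10) (k * a01) (k * a11) (k * a21) (k * a31)
    (k * a32) (k * b10) (k * b01) (k * b11) (k * b21) (k * b31) (k * b32).
Proof.
apply/matrixP => i j; rewrite !mxE.
by case: i => [[|[|[|[|[|[|[|//]]]]]]] ?];
   case: j => [[|[|[|[|[|[|[|//]]]]]]] ?] /=; ring.
Qed.

Lemma g2mxN z1 z2 a10 a01 a11 a21 a31 a32 b10 b01 b11 b21 b31 b32 :
  - @g2mx C z1 z2 a10 a01 a11 a21 a31 a32 b10 b01 b11 b21 b31 b32 =
  g2mx (- z1) (- z2) (- a10) (- a01) (- a11) (- a21) (- a31)
    (- a32) (- b10) (- b01) (- b11) (- b21) (- b31) (- b32).
Proof. by rewrite -scaleN1r g2mxZ !mulN1r. Qed.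

(** Besides being the computational form of the bracket, this shows that the
matrices of shape [g2mx] are closed under it; the square root of 2 disappears
because it only ever occurs in pairs. *)
Lemma lie_g2mx z1 z2 a10 a01 a11 a21 a31 a32 b10 b01 b11 b21 b31 b32
    z1' z2' a10' a01' a11' a21' a31' a32' b10' b01' b11' b21' b31' b32' :
  lie (@g2mx C z1 z2 a10 a01 a11 a21 a31 a32 b10 b01 b11 b21 b31 b32)
    (g2mx z1' z2' a10' a01' a11' a21' a31' a32' b10' b01' b11' b21' b31' b32')
  = g2mx
   (- 2 * (a10 * b10' - b10 * a10') + (a01 * b01' - b01 * a01') + (a11 *
     b11' - b11 * a11') - (a21 * b21' - b21 * a21') - (a31 * b31' - b31 *
     a31'))
   (3 * (a10 * b10' - b10 * a10') - 2 * (a01 * b01' - b01 * a01') - 3 * (a11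
     * b11' - b11 * a11') + (a31 * b31' - b31 * a31') - (a32 * b32' - b32 *
     a32'))
   (- (z1 * a10' - a10 * z1') - (a11 * b01' - b01 * a11') - 2 * (a21 * b11'
     - b11 * a21') + (a31 * b21' - b21 * a31'))
   (- (z2 * a01' - a01 * z2') + 3 * (a11 * b10' - b10 * a11') - (a32 * b31'
     - b31 * a32'))
   (- (z1 * a11' - a11 * z1') - (z2 * a11' - a11 * z2') - (a10 * a01' - a01
     * a10') + 2 * (a21 * b10' - b10 * a21') - (a32 * b21' - b21 * a32'))
   (- 2 * (z1 * a21' - a21 * z1') - (z2 * a21' - a21 * z2') - 2 * (a10 *
     a11' - a11 * a10') - (a31 * b10' - b10 * a31') + (a32 * b11' - b11 *
     a32'))
   (- 3 * (z1 * a31' - a31 * z1') - (z2 * a31' - a31 * z2') + 3 * (a10 *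
     a21' - a21 * a10') + (a32 * b01' - b01 * a32'))
   (- 3 * (z1 * a32' - a32 * z1') - 2 * (z2 * a32' - a32 * z2') - (a01 *
     a31' - a31 * a01') - 3 * (a11 * a21' - a21 * a11'))
   ((z1 * b10' - b10 * z1') - (a01 * b11' - b11 * a01') - 2 * (a11 * b21' -
     b21 * a11') + (a21 * b31' - b31 * a21'))
   ((z2 * b01' - b01 * z2') + 3 * (a10 * b11' - b11 * a10') - (a31 * b32' -
     b32 * a31'))
   ((z1 * b11' - b11 * z1') + (z2 * b11' - b11 * z2') + 2 * (a10 * b21' -
     b21 * a10') - (a21 * b32' - b32 * a21') + (b10 * b01' - b01 * b10'))
   (2 * (z1 * b21' - b21 * z1') + (z2 * b21' - b21 * z2') - (a10 * b31' -
     b31 * a10') + (a11 * b32' - b32 * a11') + 2 * (b10 * b11' - b11 *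
     b10'))
   (3 * (z1 * b31' - b31 * z1') + (z2 * b31' - b31 * z2') + (a01 * b32' -
     b32 * a01') - 3 * (b10 * b21' - b21 * b10'))
   (3 * (z1 * b32' - b32 * z1') + 2 * (z2 * b32' - b32 * z2') + (b01 * b31'
     - b31 * b01') + 3 * (b11 * b21' - b21 * b11')).
Proof.
have s2 := sqrtC2_sqr.
apply/matrixP => i j; rewrite !mxE !big_ord_recl !big_ord0 !mxE.
by case: i => [[|[|[|[|[|[|[|//]]]]]]] ?];
   case: j => [[|[|[|[|[|[|[|//]]]]]]] ?] /=; ring: s2.
Qed.

Section Duals.
Variables z1 z2 a10 a01 a11 a21 a31 a32 b10 b01 b11 b21 b31 b32 : C.
Let x := g2mx z1 z2 a10 a01 a11 a21 a31 a32 b10 b01 b11 b21 b31 b32.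
Let fdual_x := fdual_g2mx z1 z2 a10 a01 a11 a21 a31 a32 b10 b01 b11 b21 b31 b32.

Lemma f10'E : f10' x = a10. Proof. by have [] := fdual_x. Qed.
Lemma f11'E : f11' x = a11. Proof. by have [] := fdual_x. Qed.
Lemma f21'E : f21' x = a21. Proof. by have [] := fdual_x. Qed.
Lemma f31'E : f31' x = a31. Proof. by have [] := fdual_x. Qed.
Lemma f32'E : f32' x = a32. Proof. by have [] := fdual_x. Qed.

End Duals.

End Coordinates.

Ltac g2_coord :=
  rewrite ?h01E /Z1 /Z2 /f10 /f01 /f11 /f21 /f31 /f32 /e10 /e01 /e11 /e21 /e31
    /e32 ?(lie_g2mx, g2mxZ, g2mxN, g2mxD).

Ltac g2_field := g2_coord; congr g2mx; field.

(** * Holonomy as a least closed subspace *)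

Section Holonomy.
Context {C : numClosedFieldType}.
Implicit Types (m : @model C) (W h : {vspace 'M[C]_7}).

Definition hol_closed m W :=
  {in carrier m &, forall x y, curv m x y \in W} /\
  {in carrier m & W, forall x y, lie x y \in W}.

Lemma memv_bispan {F : fieldType} {vT : vectType F} {B : vT -> vT -> vT}
    {U V : {vspace vT}} {x y} :
  bilin B -> x \in U -> y \in V -> B x y \in bispan B U V.
Proof.
move=> /(@bispan_subP _ _ _ U V (bispan B U V)) [/(_ (subvv _)) + _].
by apply.
Qed.

Lemma holn_sub m i j : (i <= j)%N -> (holn m i <= holn m j)%VS.
Proof.
by move=> /subnK<-; elim: (j - i)%N => // k /subv_trans-> //; exact: addvSl.
Qed.

Lemma holn_sub_closed m W i : bilin (curv m) -> hol_closed m W ->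
  (holn m i <= W)%VS.
Proof.
move=> bm [cW lW]; elim: i => [|i IHi] /=.
  by apply/bispan_subP => // x y; apply: cW.
rewrite subv_add IHi; apply/bispan_subP => [|x y xm /(subvP IHi)].
  exact: lie_bilin.
exact: lW.
Qed.

(** Each strict step raises the dimension, which is bounded by that of the
ambient matrix space. *)
Lemma holn_stable m : exists N, holn m N.+1 = holn m N.
Proof.
suff E N : (exists i, holn m i.+1 = holn m i) \/ (N <= \dim (holn m N))%N.
  have [//|] := E (\dim {:'M[C]_7}).+1.
  by move=> /leq_trans/(_ (dimvS (subvf _))); rewrite ltnn.
elim: N => [|N [|leN]]; [by right | by left |].
have [eqN|neN] := eqVneq (holn m N.+1) (holn m N); first by left; exists N.
right; apply: leq_ltn_trans leN _.
rewrite ltn_neqAle dimvS ?holn_sub// andbT; apply: contraNneq neN => eqd.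
by rewrite eq_sym eqEdim holn_sub//= eqd.
Qed.

(** At a stationary index the term of the sequence is itself closed, hence it
contains h when h is below every closed subspace. *)
Lemma is_hol_least m h : bilin (curv m) -> hol_closed m h ->
  (forall W, hol_closed m W -> (h <= W)%VS) -> is_hol m h.
Proof.
move=> bm clh minh; have [N eqN] := holn_stable m.
exists N => i leNi; apply/eqP; rewrite eqEsubv holn_sub_closed//=.
apply: subv_trans (holn_sub m _ _ leNi); apply: minh; split=> x y xm.
  by move=> ym; apply: (subvP (holn_sub m _ _ (leq0n N))); apply: memv_bispan.
move=> yN; rewrite -eqN /=; apply: (subvP (addvSr _ _)).
exact: memv_bispan (lie_bilin _ _) _ _.
Qed.

End Holonomy.

(** * The carriers and curvatures in coordinates *)

Section Models.
Context {C : numClosedFieldType}.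
Implicit Types x y : 'M[C]_7.

(** The curvature is expanded for abstract arguments: substituting the
coordinates of the arguments before collecting terms would duplicate them in
every wedge. *)
Lemma curv_N6E x y : curv modelN6 x y =
  let w10_31 := wedge f10' f31' x y in let w10_32 := wedge f10' f32' x y in
  let w11_31 := wedge f11' f31' x y in let w21_31 := wedge f21' f31' x y in
  let w21_32 := wedge f21' f32' x y in let w31_32 := wedge f31' f32' x y in
  g2mx 0 0 0 (42 * w10_31 + 60 * w21_31 + 20 * w31_32) 0 0 0 0
    (- 30 * w10_31 - 40 * w21_31 - 12 * w31_32) 0 0
    (- 20 * w10_31 - 24 * w21_31 - 6 * w31_32)
    (4 * (w11_31 - w10_32) - 6 * w21_32) (8 * w10_31 + 6 * w21_31).
Proof. by cbv zeta; rewrite /curv /=; g2_field. Qed.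

Lemma curv_D6E a x y : curv (modelD6 a) x y =
  let w10_31 := wedge f10' f31' x y in let w10_32 := wedge f10' f32' x y in
  let w11_31 := wedge f11' f31' x y in let w11_32 := wedge f11' f32' x y in
  let w21_31 := wedge f21' f31' x y in
  let w21_32 := wedge f21' f32' x y in let w31_32 := wedge f31' f32' x y in
  let h := 4 * (w11_31 - w10_32) + 4 * a / 3 * w31_32 in
  g2mx (- h) (2 * h) 0 (4 * w11_32) 0 0 0 0
   (- (8 * a / 3) * w21_32) (4 * w10_31) (8 * a / 3 * w21_31)
   (4 * a / 3 * (w11_31 - w10_32) + 2 * a ^+ 2 * w31_32)
   (2 * a ^+ 2 * w21_32) (- (2 * a ^+ 2) * w21_31).
Proof. by cbv zeta; rewrite /curv /=; g2_field. Qed.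

(** The generators of the carriers are named after the f_st to which they
project in g/p. *)
Definition N6u10 : 'M[C]_7 := f10 + e01 + 6 *: e10 + 2 *: e32.
Definition N6u11 : 'M[C]_7 := f11 + Z1 - 2 *: Z2 + 2 *: e31.
Definition N6u21 : 'M[C]_7 := f21 + 9 *: e10 + 2 *: e21.
Definition N6u31 : 'M[C]_7 := f31 - 2 *: Z1 + Z2 - e11 - 4 *: e31.
Definition N6u32 : 'M[C]_7 := f32 - e10.

Lemma N6u10E : N6u10 = g2mx 0 0 1 0 0 0 0 0 6 1 0 0 0 2.
Proof. by rewrite /N6u10; g2_field. Qed.
Lemma N6u11E : N6u11 = g2mx 1 (-2) 0 0 1 0 0 0 0 0 0 0 2 0.
Proof. by rewrite /N6u11; g2_field. Qed.
Lemma N6u21E : N6u21 = g2mx 0 0 0 0 0 1 0 0 9 0 0 2 0 0.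
Proof. by rewrite /N6u21; g2_field. Qed.
Lemma N6u31E : N6u31 = g2mx (-2) 1 0 0 0 0 1 0 0 0 (-1) 0 (-4) 0.
Proof. by rewrite /N6u31; g2_field. Qed.
Lemma N6u32E : N6u32 = g2mx 0 0 0 0 0 0 0 1 (-1) 0 0 0 0 0.
Proof. by rewrite /N6u32; g2_field. Qed.

Lemma N6_gens :
  [/\ N6u10 \in carrier (@modelN6 C), N6u11 \in carrier (@modelN6 C),
      N6u21 \in carrier (@modelN6 C), N6u31 \in carrier (@modelN6 C) &
      N6u32 \in carrier (@modelN6 C)].
Proof.
have gen : {subset [:: f01; N6u10; N6u11; N6u21; N6u31; N6u32]
            <= carrier (@modelN6 C)} by move=> x; exact: memv_span.
by split; apply: gen; rewrite !inE eqxx ?orbT.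
Qed.

Definition D6u10 (a : C) := f10 + a *: e11 + e32.
Definition D6u11 (a : C) := f11 + a *: e10 + e31.
Definition D6u21 (a : C) := f21 + (a ^+ 2 + 1) *: e21.
Definition D6u31 (a : C) := f31 + e11 + (a * (a ^+ 2 + 1 / 3)) *: e32.
Definition D6u32 (a : C) := f32 + e10 + (a * (a ^+ 2 + 1 / 3)) *: e31.

Lemma D6u10E a : D6u10 a = g2mx 0 0 1 0 0 0 0 0 0 0 a 0 0 1.
Proof. by rewrite /D6u10; g2_field. Qed.
Lemma D6u11E a : D6u11 a = g2mx 0 0 0 0 1 0 0 0 a 0 0 0 1 0.
Proof. by rewrite /D6u11; g2_field. Qed.
Lemma D6u21E a : D6u21 a = g2mx 0 0 0 0 0 1 0 0 0 0 0 (a ^+ 2 + 1) 0 0.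
Proof. by rewrite /D6u21; g2_field. Qed.
Lemma D6u31E a :
  D6u31 a = g2mx 0 0 0 0 0 0 1 0 0 0 1 0 0 (a * (a ^+ 2 + 1 / 3)).
Proof. by rewrite /D6u31; g2_field. Qed.
Lemma D6u32E a :
  D6u32 a = g2mx 0 0 0 0 0 0 0 1 1 0 0 0 (a * (a ^+ 2 + 1 / 3)) 0.
Proof. by rewrite /D6u32; g2_field. Qed.

Lemma D6_gens a :
  [/\ D6u10 a \in carrier (modelD6 a), D6u11 a \in carrier (modelD6 a),
      D6u21 a \in carrier (modelD6 a), D6u31 a \in carrier (modelD6 a) &
      D6u32 a \in carrier (modelD6 a)].
Proof.
have gen : {subset [:: h01; D6u10 a; D6u11 a; D6u21 a; D6u31 a; D6u32 a]
            <= carrier (modelD6 a)} by move=> x; exact: memv_span.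
by split; apply: gen; rewrite !inE eqxx ?orbT.
Qed.

End Models.

(** Brackets and values of the curvature produce multiples of the vectors that
are looked for; this form compares coordinates without inverting k. *)
Lemma memv_scale_eq {F : fieldType} {vT : vectType F} {W : {vspace vT}}
    {k x y} :
  x \in W -> k != 0 -> k *: y = x -> y \in W.
Proof.
move=> Wx k0 eqx; rewrite -[y]scale1r -(mulVf k0) -scalerA eqx.
exact: memvZ.
Qed.

Ltac coord_eq :=
  rewrite ?(D6u10E, D6u11E, D6u21E, D6u31E, D6u32E)
    ?(N6u10E, N6u11E, N6u21E, N6u31E, N6u32E) ?(curv_D6E, curv_N6E)
    /wedge ?(f10'E, f11'E, f21'E, f31'E, f32'E); g2_field.

Ltac memv_from k H :=
  apply: (memv_scale_eq (k := k) H);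
    [by rewrite ?oppr_eq0 ?oner_eq0 ?pnatr_eq0 | by coord_eq].

(** * Models with full holonomy *)

Section FullHolonomy.
Context {C : numClosedFieldType}.
Implicit Types (W : {vspace 'M[C]_7}) (x y : 'M[C]_7).

Lemma g2mx_g2 z1 z2 a10 a01 a11 a21 a31 a32 b10 b01 b11 b21 b31 b32 :
  g2mx z1 z2 a10 a01 a11 a21 a31 a32 b10 b01 b11 b21 b31 b32 \in @g2 C.
Proof. by apply/g2P; do 14 eexists. Qed.

Lemma lie_g2 : lie_subalgebra (@g2 C).
Proof.
move=> x y /g2P[? [? [? [? [? [? [? [? [? [? [? [? [? [? ->]]]]]]]]]]]]]].
move=> /g2P[? [? [? [? [? [? [? [? [? [? [? [? [? [? ->]]]]]]]]]]]]]].
by rewrite lie_g2mx; apply/g2P; do 14 eexists.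
Qed.

Lemma h01_g2 : h01 \in @g2 C.
Proof. by apply: lie_g2; apply: g2mx_g2. Qed.

Lemma hol_closed_N6_g2 : hol_closed modelN6 (@g2 C).
Proof.
split=> [x y _ _|x y xm] /=.
  by do ?[exact: g2mx_g2 | apply: memvD | rewrite memvN | apply: memvZ].
apply: lie_g2; apply: subvP xm; apply/span_subvP.
by apply/allP; rewrite /= !andbT; do ?[apply/andP; split];
  do ?[exact: g2mx_g2 | apply: memvD | rewrite memvN | apply: memvZ].
Qed.

Lemma hol_closed_D6_g2 a : hol_closed (modelD6 a) (@g2 C).
Proof.
split=> [x y _ _|x y xm] /=.
  by do ?[exact: h01_g2 | exact: g2mx_g2 | apply: memvD | rewrite memvN
    | apply: memvZ].
apply: lie_g2; apply: subvP xm; apply/span_subvP.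
by apply/allP; rewrite /= !andbT; do ?[apply/andP; split];
  do ?[exact: h01_g2 | exact: g2mx_g2 | apply: memvD | apply: memvZ].
Qed.

(** The root vector e31 is a value of the curvature, up to scaling.  The other
generators of g are leading terms of brackets of f with the vectors already
found; the term e01 of the generator above f10 also raises e31 to e32. *)
Lemma g2_least_N6 W : hol_closed modelN6 W -> (g2 <= W)%VS.
Proof.
move=> [cW lW].
have [u10 u11 u21 u31 u32] := @N6_gens C.
have We31 : e31 \in W by memv_from (4 : C) (cW _ _ u11 u31).
have Wf01 : f01 \in W by memv_from (- 1 : C) (lW _ _ u32 We31).
have We10 : e10 \in W by memv_from (1 : C) (lW _ _ u21 We31).
have We21 : e21 \in W.
  by memv_from (- 6 : C) (memvD (cW _ _ u31 u32)
    (memvD (memvZ (- 20) Wf01) (memvZ 12 We10))).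
have We32 : e32 \in W by memv_from (1 : C) (memvD (lW _ _ u10 We31) We21).
have WZ2 : Z2 \in W by memv_from (- 1 : C) (lW _ _ u32 We32).
have WZ1 : Z1 \in W.
  by memv_from (- 1 : C) (memvD (lW _ _ u21 We21) (memvZ 27 We31)).
have We11 : e11 \in W by memv_from (- 1 : C) (lW _ _ u21 We32).
have We01 : e01 \in W.
  by memv_from (- 1 : C) (memvD (lW _ _ u31 We32) (memvZ 4 We32)).
have Wf11 : f11 \in W.
  by memv_from (- 1 : C) (memvD (lW _ _ u32 We21) (memvZ (- 3) We31)).
have Wf10 : f10 \in W.
  by memv_from (1 : C) (memvD (lW _ _ u31 We21) (memvZ 3 (memvD We21 We32))).
have Wf21 : f21 \in W.
  by memv_from (- 1 : C) (memvD (lW _ _ u31 We10)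
    (memvD (memvZ 2 We10) (memvZ (- 2) We21))).
have Wf31 : f31 \in W.
  by memv_from (1 : C) (memvD (lW _ _ u31 WZ2)
    (memvD (memvZ (- 1) We11) (memvZ (- 4) We31))).
have Wf32 : f32 \in W.
  by memv_from (1 : C) (memvD (lW _ _ u31 Wf01) (memvD Wf01 We10)).
by apply/span_subvP/allP; rewrite /= WZ1 WZ2 Wf10 Wf01 Wf11 Wf21 Wf31 Wf32
  We10 We01 We11 We21 We31 We32.
Qed.

(** The curvature supplies the positive root vector e21, provided that a is
nonzero; brackets with f then lead from e21 to all of g, since the generators of
f have the negative root vectors f_st as leading terms. *)
Lemma g2_least_D6 a W : a != 0 -> hol_closed (modelD6 a) W -> (g2 <= W)%VS.
Proof.
move=> a0 [cW lW].
have [u10 u11 u21 u31 u32] := D6_gens a.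
have n0 n : n.+1%:R != 0 :> C by rewrite pnatr_eq0.
have We01 : e01 \in W by memv_from (4 : C) (cW _ _ u10 u31).
have Wf01 : f01 \in W by memv_from (4 : C) (cW _ _ u11 u32).
have Wr10 : 4 *: e10 - (3 * a) *: e31 \in W.
  apply: (memv_scale_eq (k := - (2 * a / 3)) (cW _ _ u21 u32)).
    by rewrite oppr_eq0 !mulf_neq0 ?invr_eq0 ?n0.
  by coord_eq.
have Wr11 : 4 *: e11 - (3 * a) *: e32 \in W.
  apply: (memv_scale_eq (k := 2 * a / 3) (cW _ _ u21 u31)).
    by rewrite !mulf_neq0 ?invr_eq0 ?n0.
  by coord_eq.
(* The values of the curvature at (u10, u32) and (u31, u32) are combinations
   of h01 and e21, with determinant - 56 a^2 / 9: each of these two vectors is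
   isolated by eliminating the other. *)
have Wh01 : h01 \in W.
  apply: (memv_scale_eq (k := - (28 * a / 3))
    (memvD (memvZ (3 * a) (cW _ _ u10 u32)) (memvZ 2 (cW _ _ u31 u32)))).
    by rewrite oppr_eq0 !mulf_neq0 ?invr_eq0 ?n0.
  by coord_eq.
have We21 : e21 \in W.
  apply: (memv_scale_eq (k := 14 * a ^+ 2 / 3)
    (memvD (memvZ a (cW _ _ u10 u32)) (memvZ 3 (cW _ _ u31 u32)))).
    by rewrite !mulf_neq0 ?invr_eq0 ?n0.
  by coord_eq.
have WZ1 : Z1 \in W by memv_from (- 1 : C) (lW _ _ u21 We21).
have WZ2 : Z2 \in W by memv_from (2 : C) (memvD Wh01 WZ1).
have We11 : e11 \in W by memv_from (6 : C) (memvD (lW _ _ u10 We21) Wr11).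
have We10 : e10 \in W.
  by memv_from (6 : C) (memvD (memvZ (-1) (lW _ _ u11 We21)) Wr10).
have We32 : e32 \in W.
  apply: (memv_scale_eq (k := 3 * a)
    (memvD (lW _ _ u10 We21) (memvZ (- 2) We11))); first by rewrite mulf_neq0.
  by coord_eq.
have We31 : e31 \in W.
  apply: (memv_scale_eq (k := - (3 * a))
    (memvD (lW _ _ u11 We21) (memvZ 2 We10))).
    by rewrite oppr_eq0 mulf_neq0.
  by coord_eq.
have Wf10 : f10 \in W.
  by memv_from (1 : C) (memvD (lW _ _ u31 We21) (memvZ (- 3) We32)).
have Wf11 : f11 \in W.
  by memv_from (- 1 : C) (memvD (lW _ _ u32 We21) (memvZ 3 We31)).
have Wf21 : f21 \in W.
  by memv_from (4 : C) (memvD (memvZ (- 1) (lW _ _ u31 Wr10))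
    (memvD (memvZ (3 * a) WZ1) (memvD (memvZ (- (3 * a)) WZ2)
      (memvZ (- 8) We21)))).
have Wf31 : f31 \in W.
  by memv_from (1 : C) (memvD (memvZ (- 1) (lW _ _ u31 Wh01))
    (memvD (memvZ (- 1) We11) (memvZ (- (a / 3 + a ^+ 3)) We32))).
have Wf32 : f32 \in W.
  by memv_from (1 : C) (memvD (lW _ _ u32 Wh01)
    (memvD (memvZ (- 1) We10) (memvZ (- (a / 3 + a ^+ 3)) We31))).
by apply/span_subvP/allP; rewrite /= WZ1 WZ2 Wf10 Wf01 Wf11 Wf21 Wf31 Wf32
  We10 We01 We11 We21 We31 We32.
Qed.

Lemma is_hol_N6 : is_hol (@modelN6 C) g2.
Proof.
have [_ bilN6 _] := @curv_bilin C.
exact: is_hol_least bilN6 hol_closed_N6_g2 g2_least_N6.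
Qed.

Lemma is_hol_D6 a : a != 0 -> is_hol (@modelD6 C a) g2.
Proof.
have [_ _ bilD6] := @curv_bilin C; move=> a0.
exact: is_hol_least (bilD6 a) (hol_closed_D6_g2 a) (g2_least_D6 a ^~ a0).
Qed.

End FullHolonomy.

(** * The Heisenberg holonomy of N.7 *)

Section HolonomyN7.
Context {C : numClosedFieldType}.
Implicit Types (W : {vspace 'M[C]_7}) (x y : 'M[C]_7).

Definition heis_g2 : {vspace 'M[C]_7} := <<[:: f01; f11; f21; f31; f32]%R>>%VS.

Definition heis_g2mx (a01 a11 a21 a31 a32 : C) :=
  g2mx 0 0 0 a01 a11 a21 a31 a32 0 0 0 0 0 0.

Lemma heis_g2P x : reflect
  (exists a01 a11 a21 a31 a32, x = heis_g2mx a01 a11 a21 a31 a32)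
  (x \in heis_g2).
Proof.
have E a01 a11 a21 a31 a32 : heis_g2mx a01 a11 a21 a31 a32 =
    a01 *: f01 + (a11 *: f11 + (a21 *: f21 + (a31 *: f31 + a32 *: f32))).
  by rewrite /heis_g2mx; g2_field.
apply: (iffP idP) => [|[a01[a11[a21[a31[a32]]]]]].
  rewrite /heis_g2.
  do 4 rewrite span_cons => /memv_addP[_ /vlineP[? ->] [? + ->]].
  rewrite span_seq1 => /vlineP[? ->].
  by do 5 eexists; rewrite E; reflexivity.
move->; rewrite E.
by do !apply: memvD; apply/memvZ/memv_span; rewrite !inE eqxx ?orbT.
Qed.

(** The bracket is a symplectic form in (a01, a11, a21, a31) with values in the
line of f32, for which f01 pairs with f31 and f11 with f21. *)
Lemma lie_heis_g2mx a01 a11 a21 a31 a32 b01 b11 b21 b31 b32 :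
  lie (heis_g2mx a01 a11 a21 a31 a32) (heis_g2mx b01 b11 b21 b31 b32) =
  heis_g2mx 0 0 0 0
   (3 * (a21 * b11 - a11 * b21) - (a01 * b31 - a31 * b01)).
Proof. by rewrite /heis_g2mx; g2_field. Qed.

Lemma carrier_N7P c x : x \in carrier (modelN7 c) ->
  exists z2 a10 a01 a11 a21 a31 a32,
    x = g2mx 0 z2 a10 a01 a11 a21 a31 a32 (a10 * c) 0 0 0 0 0.
Proof.
rewrite /=; do 6 rewrite span_cons => /memv_addP[_ /vlineP[? ->] [? + ->]].
by rewrite span_seq1 => /vlineP[? ->]; do 7 eexists; g2_coord; congr g2mx;
  rewrite ?(mulr0, mulr1, add0r, addr0).
Qed.

Lemma hol_closed_N7 c : hol_closed (modelN7 c) heis_g2.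
Proof.
split=> [x y _ _|x y]; first by apply/memvZ/memv_span; rewrite inE eqxx.
move=> /carrier_N7P[? [? [? [? [? [? [? ->]]]]]]].
move=> /heis_g2P[? [? [? [? [? ->]]]]].
rewrite lie_g2mx; apply/heis_g2P; do 5 eexists.
by congr g2mx; first [reflexivity | ring].
Qed.

(** The single curvature direction f01 is carried by repeated brackets with
f10 + c e10 to f11, f21 and f31, up to scaling and earlier terms; moreover
[f31, f01] = f32. *)
Lemma heis_g2_least_N7 c W : hol_closed (modelN7 c) W -> (heis_g2 <= W)%VS.
Proof.
move=> [cW lW].
have u10 : f10 + c *: e10 \in carrier (modelN7 c).
  by apply: memv_span; rewrite !inE eqxx ?orbT.
have u31 : f31 \in carrier (modelN7 c).
  by apply: memv_span; rewrite !inE eqxx ?orbT.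
have Wf01 : f01 \in W.
  apply: (memv_scale_eq (k := 1) (cW _ _ u10 u31)); first exact: oner_neq0.
  by rewrite /=; g2_coord; rewrite /wedge !(f10'E, f31'E); g2_field.
have Wf11 : f11 \in W by memv_from (- 1 : C) (lW _ _ u10 Wf01).
have Wf32 : f32 \in W by memv_from (1 : C) (lW _ _ u31 Wf01).
have Wf21 : f21 \in W.
  by memv_from (- 2 : C) (memvD (lW _ _ u10 Wf11) (memvZ (3 * c) Wf01)).
have Wf31 : f31 \in W.
  by memv_from (3 : C) (memvD (lW _ _ u10 Wf21) (memvZ (2 * c) Wf11)).
by apply/span_subvP/allP; rewrite /= Wf01 Wf11 Wf21 Wf31 Wf32.
Qed.

Lemma is_hol_N7 c : is_hol (modelN7 c) heis_g2.
Proof.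
have [bilN7 _ _] := @curv_bilin C.
exact: is_hol_least (bilN7 c) (hol_closed_N7 c) (heis_g2_least_N7 c).
Qed.

End HolonomyN7.

(** * The holonomy of D.6 at the parameter 0 *)

Section HolonomyD60.
Context {C : numClosedFieldType}.
Implicit Types (W : {vspace 'M[C]_7}) (x y : 'M[C]_7).

Definition sl3_g2 : {vspace 'M[C]_7} :=
  <<[:: h01; e01; f01; f21 + e21; f10 + e32; f11 + e31; f31 + e11;
        f32 + e10]%R>>%VS.

Definition sl3_g2mx (t b01 a01 a21 a10 a11 a31 a32 : C) :=
  g2mx (- t) (2 * t) a10 a01 a11 a21 a31 a32 a32 b01 a31 a21 a11 a10.

Lemma sl3_g2P x : reflect
  (exists t b01 a01 a21 a10 a11 a31 a32,
     x = sl3_g2mx t b01 a01 a21 a10 a11 a31 a32)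
  (x \in sl3_g2).
Proof.
have E t b01 a01 a21 a10 a11 a31 a32 :
    sl3_g2mx t b01 a01 a21 a10 a11 a31 a32 =
    t *: h01 + (b01 *: e01 + (a01 *: f01 + (a21 *: (f21 + e21) +
    (a10 *: (f10 + e32) + (a11 *: (f11 + e31) + (a31 *: (f31 + e11) +
    a32 *: (f32 + e10))))))).
  by rewrite /sl3_g2mx; g2_field.
apply: (iffP idP) => [|[t[b01[a01[a21[a10[a11[a31[a32]]]]]]]]].
  rewrite /sl3_g2.
  do 7 rewrite span_cons => /memv_addP[_ /vlineP[? ->] [? + ->]].
  rewrite span_seq1 => /vlineP[? ->].
  by do 8 eexists; rewrite E; reflexivity.
move->; rewrite E.
by do !apply: memvD; apply/memvZ/memv_span; rewrite !inE eqxx ?orbT.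
Qed.

Lemma g2mx_sl3_g2 z1 z2 a10 a01 a11 a21 a31 a32 b10 b01 b11 b21 b31 b32 :
  z2 = - 2 * z1 -> b10 = a32 -> b11 = a31 -> b21 = a21 -> b31 = a11 ->
  b32 = a10 ->
  g2mx z1 z2 a10 a01 a11 a21 a31 a32 b10 b01 b11 b21 b31 b32 \in sl3_g2.
Proof.
move=> -> -> -> -> -> ->; apply/sl3_g2P.
exists (- z1), b01, a01, a21, a10, a11, a31, a32.
by rewrite /sl3_g2mx; congr g2mx; ring.
Qed.

Lemma lie_sl3_g2 : lie_subalgebra sl3_g2.
Proof.
move=> x y /sl3_g2P[t[b01[a01[a21[a10[a11[a31[a32 ->]]]]]]]].
move=> /sl3_g2P[t'[b01'[a01'[a21'[a10'[a11'[a31'[a32' ->]]]]]]]].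
by rewrite /sl3_g2mx lie_g2mx; apply: g2mx_sl3_g2; ring.
Qed.

(** The carrier of D.6_0 lies in this subalgebra, which makes the stability
under bracketing automatic. *)
Lemma hol_closed_D6_0 : hol_closed (modelD6 0) sl3_g2.
Proof.
split=> [x y _ _|x y xm].
  by rewrite curv_D6E; apply: g2mx_sl3_g2; ring.
apply: lie_sl3_g2; apply: subvP xm; apply/span_subvP => z.
rewrite !inE => /or4P[/eqP->|/eqP->|/eqP->|/or3P[]/eqP->].
- by g2_coord; apply: g2mx_sl3_g2; ring.
- by rewrite -/(D6u10 0) D6u10E; apply: g2mx_sl3_g2; ring.
- by rewrite -/(D6u11 0) D6u11E; apply: g2mx_sl3_g2; ring.
- by rewrite -/(D6u21 0) D6u21E; apply: g2mx_sl3_g2; ring.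
- by rewrite -/(D6u31 0) D6u31E; apply: g2mx_sl3_g2; ring.
- by rewrite -/(D6u32 0) D6u32E; apply: g2mx_sl3_g2; ring.
Qed.

(** The curvature spans the copy <h01, e01, f01> of sl_2, and h01 acts on u10,
u11, u31, u32 with eigenvalues 1 and -1, so that these belong to W;
[u10, u11] then gives f21 + e21. *)
Lemma sl3_g2_least_D6_0 W : hol_closed (modelD6 0) W -> (sl3_g2 <= W)%VS.
Proof.
move=> [cW lW].
have [u10 u11 _ u31 u32] := D6_gens (0 : C).
have We01 : e01 \in W by memv_from (4 : C) (cW _ _ u10 u31).
have Wf01 : f01 \in W by memv_from (4 : C) (cW _ _ u11 u32).
have Wh01 : h01 \in W by memv_from (- 4 : C) (cW _ _ u10 u32).
have W10 : f10 + e32 \in W by memv_from (- 1 : C) (lW _ _ u10 Wh01).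
have W11 : f11 + e31 \in W by memv_from (1 : C) (lW _ _ u11 Wh01).
have W31 : f31 + e11 \in W by memv_from (- 1 : C) (lW _ _ u31 Wh01).
have W32 : f32 + e10 \in W by memv_from (1 : C) (lW _ _ u32 Wh01).
have W21 : f21 + e21 \in W by memv_from (- 2 : C) (lW _ _ u10 W11).
by apply/span_subvP/allP; rewrite /= Wh01 We01 Wf01 W21 W10 W11 W31 W32.
Qed.

Lemma is_hol_D6_0 : is_hol (modelD6 0) sl3_g2.
Proof.
have [_ _ bilD6] := @curv_bilin C.
exact: is_hol_least (bilD6 0) hol_closed_D6_0 sl3_g2_least_D6_0.
Qed.

End HolonomyD60.

(** * Isomorphisms of matrix Lie algebras *)

Lemma lie_isomorphic_linear {F : fieldType} {m n : nat}
    {U : {vspace 'M[F]_m}} {V : {vspace 'M[F]_n}}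
    (phi : 'M[F]_m -> 'M[F]_n) :
  linear phi -> lie_subalgebra U -> lie_subalgebra V ->
  {in U, forall x, phi x \in V} ->
  {in V, forall y, exists2 x, x \in U & phi x = y} ->
  {in U, forall x, phi x = 0 -> x = 0} ->
  {in U &, forall x y, phi (lie x y) = lie (phi x) (phi y)} ->
  lie_isomorphic U V.
Proof.
move=> lphi lieU lieV phiV phi_surj phi_inj phi_lie; split=> //.
pose phiL : {linear 'M[F]_m -> 'M[F]_n} :=
  HB.pack phi (GRing.isLinear.Build F _ _ _ phi lphi).
exists (linfun phiL); split=> [||x y Ux Uy];
  last by rewrite !lfunE; apply: phi_lie.
- apply/vspaceP => y; apply/memv_imgP/idP => [[x Ux ->]|/phi_surj[x Ux <-]].
    by rewrite lfunE; apply: phiV.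
  by exists x; rewrite // lfunE.
- apply/eqP; rewrite -subv0; apply/subvP => x; rewrite memv_cap memv_ker lfunE.
  by case/andP=> Ux /eqP/(phi_inj _ Ux)->; rewrite mem0v.
Qed.

Section Iso.
Context {C : numClosedFieldType}.
Implicit Types (x y : 'M[C]_7).

Definition heis_mx (p1 p2 q1 q2 z : C) : 'M[C]_4 :=
  \matrix_(i < 4, j < 4) nth 0 (nth [::] [::
    [:: 0; p1; p2; z]; [:: 0; 0; 0; q1]; [:: 0; 0; 0; q2];
    [:: 0; 0; 0; 0]] i) j.

Lemma heisenberg2P (x : 'M[C]_4) : reflect
  (exists p1 p2 q1 q2 z, x = heis_mx p1 p2 q1 q2 z) (x \in heisenberg C 2).
Proof.
have E p1 p2 q1 q2 z : heis_mx p1 p2 q1 q2 z =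
    p1 *: delta_mx 0 1 + (p2 *: delta_mx 0 2 + (q1 *: delta_mx 1 3 +
    (q2 *: delta_mx 2 3 + z *: delta_mx 0 3))).
  apply/matrixP => i j; rewrite !mxE -!val_eqE /=.
  by case: i => [[|[|[|[|//]]]] ?]; case: j => [[|[|[|[|//]]]] ?] /=; ring.
have -> : heisenberg C 2 = <<[:: delta_mx 0 1; delta_mx 0 2; delta_mx 1 3;
    delta_mx 2 3; delta_mx 0 3]%R>>%VS.
  rewrite /heisenberg /image_mem !enum_ordSl (size0nil (size_enum_ord 0)) /=.
  by congr <<[:: delta_mx _ _; delta_mx _ _; delta_mx _ _; delta_mx _ _;
    delta_mx _ _]%R>>%VS; apply/val_inj.
apply: (iffP idP) => [|[p1[p2[q1[q2[z]]]]]].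
  do 4 rewrite span_cons => /memv_addP[_ /vlineP[? ->] [? + ->]].
  rewrite span_seq1 => /vlineP[? ->].
  by do 5 eexists; rewrite E; reflexivity.
move->; rewrite E.
by do !apply: memvD; apply/memvZ/memv_span; rewrite !inE eqxx ?orbT.
Qed.

Lemma lie_heis_mx p1 p2 q1 q2 z p1' p2' q1' q2' z' :
  lie (heis_mx p1 p2 q1 q2 z) (heis_mx p1' p2' q1' q2' z') =
  heis_mx 0 0 0 0 (p1 * q1' + p2 * q2' - (p1' * q1 + p2' * q2)).
Proof.
apply/matrixP => i j; rewrite !mxE !big_ord_recl !big_ord0 !mxE.
by case: i => [[|[|[|[|//]]]] ?]; case: j => [[|[|[|[|//]]]] ?] /=; ring.
Qed.

(** The first row holds the coordinates on the Lagrangian plane <f01, f21> and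
the last column those on <f11, f31>.  The factor 3 and the sign turn the
symplectic form of [lie_heis_g2mx] into that of [lie_heis_mx]. *)
Definition heis_map x : 'M[C]_4 :=
  heis_mx (3 * f21' x) (- x (inord 2) (inord 1)) (f11' x) (f31' x) (f32' x).

Lemma heis_map_linear : linear heis_map.
Proof.
have [_ l11 l21 l31 l32] := @fdual_linear C.
move=> a x y; apply/matrixP => i j; rewrite /heis_map l11 l21 l31 l32 !mxE.
by case: i => [[|[|[|[|//]]]] ?]; case: j => [[|[|[|[|//]]]] ?] /=;
  rewrite /GRing.scale /=; ring.
Qed.

Lemma heis_mapE a01 a11 a21 a31 a32 :
  heis_map (heis_g2mx a01 a11 a21 a31 a32) =
  heis_mx (3 * a21) (- a01) a11 a31 a32.
Proof.
rewrite /heis_map !(f21'E, f11'E, f31'E, f32'E).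
by congr heis_mx; rewrite !mxE !inordK.
Qed.

Lemma heis_mx_inj p1 p2 q1 q2 z : heis_mx p1 p2 q1 q2 z = 0 ->
  [/\ p1 = 0, p2 = 0, q1 = 0, q2 = 0 & z = 0].
Proof.
move=> /matrixP E; split.
- by have := E 0 1; rewrite !mxE.
- by have := E 0 2; rewrite !mxE.
- by have := E 1 3; rewrite !mxE.
- by have := E 2 3; rewrite !mxE.
- by have := E 0 3; rewrite !mxE.
Qed.

Lemma heis_g2_iso : lie_isomorphic (@heis_g2 C) (heisenberg C 2).
Proof.
have n3 : 3 != 0 :> C by rewrite pnatr_eq0.
apply: (lie_isomorphic_linear heis_map heis_map_linear).
- move=> x y /heis_g2P[? [? [? [? [? ->]]]]] /heis_g2P[? [? [? [? [? ->]]]]].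
  by rewrite lie_heis_g2mx; apply/heis_g2P; do 5 eexists.
- move=> x y /heisenberg2P[? [? [? [? [? ->]]]]].
  move=> /heisenberg2P[? [? [? [? [? ->]]]]].
  by rewrite lie_heis_mx; apply/heisenberg2P; do 5 eexists.
- move=> x /heis_g2P[? [? [? [? [? ->]]]]].
  by rewrite heis_mapE; apply/heisenberg2P; do 5 eexists.
- move=> x /heisenberg2P[p1 [p2 [q1 [q2 [z ->]]]]].
  exists (heis_g2mx (- p2) q1 (p1 / 3) q2 z).
    by apply/heis_g2P; do 5 eexists.
  by rewrite heis_mapE opprK mulrC divfK.
- move=> x /heis_g2P[a01 [a11 [a21 [a31 [a32 ->]]]]].
  rewrite heis_mapE => /heis_mx_inj[/eqP + /eqP + -> -> ->].
  rewrite mulf_eq0 (negPf n3) oppr_eq0 /= => /eqP-> /eqP->.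
  by rewrite /heis_g2mx g2mxE !scale0r !addr0.
- move=> x y /heis_g2P[? [? [? [? [? ->]]]]] /heis_g2P[? [? [? [? [? ->]]]]].
  by rewrite lie_heis_g2mx !heis_mapE lie_heis_mx; congr heis_mx; ring.
Qed.

Definition sl3_mx (t b01 a01 a21 a10 a11 a31 a32 : C) : 'M[C]_3 :=
  \matrix_(i < 3, j < 3) nth 0 (nth [::] [::
    [:: - 2 * a21; a32 - a11; a31 + a10];
    [:: 2 * (a10 - a31); a21 + t; b01];
    [:: 2 * (a11 + a32); a01; a21 - t]] i) j.

(** The columns span a subspace of C^7 that [sl3_g2] preserves.  They are
eigenvectors of f21 + e21, which commutes with the Levi part <h01, e01, f01>:
the first one has eigenvalue -2, the other two, on which that sl_2 acts by its
standard representation, have eigenvalue 1. *)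
Definition triplet : 'M[C]_(7, 3) :=
  \matrix_(i < 7, j < 3) nth 0 (nth [::] [::
    [:: 1; 0; 0]; [:: 0; 1; 0]; [:: 0; 0; 1]; [:: - sqrtC 2; 0; 0];
    [:: 0; -1; 0]; [:: 0; 0; 1]; [:: -1; 0; 0]] i) j.

(** A left inverse of [triplet], so that [first3 *m x *m triplet] is the matrix
of the restriction of x whenever x preserves the span of the columns. *)
Definition first3 : 'M[C]_(3, 7) := \matrix_(i, j) (val i == val j)%:R.

Lemma first3_triplet : first3 *m triplet = 1%:M.
Proof.
apply/matrixP => i j; rewrite !mxE !big_ord_recl !big_ord0 !mxE.
by case: i => [[|[|[|//]]] ?]; case: j => [[|[|[|//]]] ?] /=; ring.
Qed.

Lemma sl3_g2mx_triplet t b01 a01 a21 a10 a11 a31 a32 :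
  sl3_g2mx t b01 a01 a21 a10 a11 a31 a32 *m triplet =
  triplet *m sl3_mx t b01 a01 a21 a10 a11 a31 a32.
Proof.
have s2 := @sqrtC2_sqr C.
apply/matrixP => i j; rewrite !mxE !big_ord_recl !big_ord0 !mxE.
by case: i => [[|[|[|[|[|[|[|//]]]]]]] ?]; case: j => [[|[|[|//]]] ?] /=;
  ring: s2.
Qed.

Definition sl3_map : 'M[C]_7 -> 'M[C]_3 := mulmx first3 \o mulmxr triplet.

Lemma sl3_mapE t b01 a01 a21 a10 a11 a31 a32 :
  sl3_map (sl3_g2mx t b01 a01 a21 a10 a11 a31 a32) =
  sl3_mx t b01 a01 a21 a10 a11 a31 a32.
Proof.
by rewrite /sl3_map /= sl3_g2mx_triplet mulmxA first3_triplet mul1mx.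
Qed.

Lemma sl3_g2_triplet x : x \in sl3_g2 -> x *m triplet = triplet *m sl3_map x.
Proof.
move=> /sl3_g2P[t[b01[a01[a21[a10[a11[a31[a32 ->]]]]]]]].
by rewrite sl3_mapE sl3_g2mx_triplet.
Qed.

Definition sl3_inv (M : 'M[C]_3) : 'M[C]_7 :=
  sl3_g2mx ((M 1 1 - M 2 2) / 2) (M 1 2) (M 2 1) (- M 0 0 / 2)
    (M 0 2 / 2 + M 1 0 / 4) (M 2 0 / 4 - M 0 1 / 2) (M 0 2 / 2 - M 1 0 / 4)
    (M 2 0 / 4 + M 0 1 / 2).

Lemma sl3_mxK t b01 a01 a21 a10 a11 a31 a32 :
  sl3_inv (sl3_mx t b01 a01 a21 a10 a11 a31 a32) =
  sl3_g2mx t b01 a01 a21 a10 a11 a31 a32.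
Proof.
by rewrite /sl3_inv !mxE /=; congr sl3_g2mx; field.
Qed.

Lemma sl3_inv0 : sl3_inv 0 = 0.
Proof.
by rewrite /sl3_inv /sl3_g2mx !mxE !(oppr0, mul0r, addr0, mulr0) g2mxE !scale0r
  !addr0.
Qed.

Lemma sl3_invK M : \tr M = 0 -> sl3_map (sl3_inv M) = M.
Proof.
rewrite /mxtrace !big_ord_recl big_ord0 addr0.
have [l1 l2] :
    lift ord0 ord0 = 1 :> 'I_3 /\ lift ord0 (lift ord0 ord0) = 2 :> 'I_3.
  by split; apply/val_inj.
rewrite l1 l2.
move=> /eqP; rewrite addrA addr_eq0 => /eqP tr0.
rewrite /sl3_inv sl3_mapE; apply/matrixP.
have M22 : M 2 2 = - (M 0 0 + M 1 1) by rewrite tr0 opprK.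
have E k (lt_k : (k < 3)%N) : Ordinal lt_k = inord k.
  by apply/val_inj; rewrite /= inordK.
have [i0 i1 i2] : [/\ inord 0 = 0 :> 'I_3, inord 1 = 1 :> 'I_3
    & inord 2 = 2 :> 'I_3].
  by split; apply/val_inj; rewrite /= inordK.
move=> i j; rewrite mxE.
by case: i => [[|[|[|//]]] ?]; case: j => [[|[|[|//]]] ?] /=;
  rewrite !E ?(i0, i1, i2) ?M22; field.
Qed.

(** Compatibility with brackets needs no coordinates: if x *m T = T *m phi x and
y *m T = T *m phi y, then x *m y *m T = T *m (phi x *m phi y), and T has a left
inverse. *)
Lemma sl3_g2_iso : lie_isomorphic (@sl3_g2 C) (sl C 3).
Proof.
apply: (lie_isomorphic_linear sl3_map).
- by move=> a x y; rewrite /sl3_map /= mulmxDl mulmxDr -scalemxAl -scalemxAr.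
- exact: lie_sl3_g2.
- by move=> x y _ _; rewrite memv_sl /lie linearB /= mxtrace_mulC subrr.
- move=> x /sl3_g2P[t[b01[a01[a21[a10[a11[a31[a32 ->]]]]]]]].
  rewrite sl3_mapE memv_sl /mxtrace !big_ord_recl big_ord0 !mxE /=.
  by apply/eqP; ring.
- move=> M; rewrite memv_sl => /eqP tr0.
  exists (sl3_inv M); last exact: sl3_invK.
  by apply/sl3_g2P; do 8 eexists.
- move=> x /sl3_g2P[t[b01[a01[a21[a10[a11[a31[a32 ->]]]]]]]].
  by rewrite sl3_mapE -sl3_mxK => ->; exact: sl3_inv0.
- move=> x y hx hy; have hxy := lie_sl3_g2 _ _ hx hy.
  have lie_triplet u v : u \in sl3_g2 -> v \in sl3_g2 ->
      u *m v *m triplet = triplet *m (sl3_map u *m sl3_map v).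
    move=> hu hv; rewrite -mulmxA sl3_g2_triplet // (mulmxA u triplet).
    by rewrite sl3_g2_triplet // (mulmxA triplet).
  rewrite -[LHS]mul1mx -first3_triplet -(mulmxA first3) -sl3_g2_triplet //.
  rewrite /lie mulmxBl !lie_triplet // -mulmxBr (mulmxA first3).
  by rewrite first3_triplet mul1mx.
Qed.

End Iso.

(** * Holonomy of the multiply-transitive models *)

Theorem theorem7p1 (R : realType) :
  [/\ forall c : R[i],
        let h : {vspace 'M[R[i]]_7} := <<[:: f01; f11; f21; f31; f32]%R>>%VS in
        is_hol (modelN7 c) h /\ lie_isomorphic h (heisenberg R[i] 2),
      is_hol (@modelN6 R[i]) g2,
      forall a : R[i], a != 0 -> is_hol (modelD6 a) g2 &
      let h : {vspace 'M[R[i]]_7} :=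
        <<[:: h01; e01; f01; f21 + e21; f10 + e32; f11 + e31;
              f31 + e11; f32 + e10]%R>>%VS in
      is_hol (modelD6 (0 : R[i])) h /\ lie_isomorphic h (sl R[i] 3)].
Proof.
split=> [c||a|].
- by split; [exact: is_hol_N7 | exact: heis_g2_iso].
- exact: is_hol_N6.
- exact: is_hol_D6.
- by split; [exact: is_hol_D6_0 | exact: sl3_g2_iso].
Qed.
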